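(* Let $\mathcal{A}$ be a Markovian automaton on $\tilde A$ whose support consists of reduced words, and let $(\mathbb{R}_n)_n$ be the sequence of probability measures it determines. If $\mathcal{A}$ does not have a cycle with probability $1$, then $(\mathbb{R}_n)_n$ is a prefix-heavy sequence of measures on reduced words, with parameters $(C,\alpha)$, for some $C\ge1$ and $\alpha\in(0,1)$ computable from $\mathcal{A}$.
   Context: $A$ is a finite non-empty alphabet, $\tilde A=A\sqcup A^{-1}$. A word over $\tilde A$ is reduced if it has no factor $aa^{-1}$ ($a\in\tilde A$); $\mathcal{R}$ is the set of reduced words (including the empty word), $\mathcal{R}_n$ those of length $n$. For $u\in\mathcal{R}$, $\mathcal{P}(u)$ is the set of reduced words having $u$ as a prefix (empty if $u$ is not reduced). A Markovian automaton $\mathcal{A}$ on an alphabet $X$ consists of: a deterministic transition system $(Q,\cdot)$ with $Q$ a finite non-empty set of states and, for each $q\in Q$, $x\in X$, either $q\cdot x\in Q$ or $q\cdot x$ undefined; an initial probability vector $\gamma_0\in[0,1]^Q$, $\sum_q\gamma_0(q)=1$; and for each $p\in Q$ a probability vector $(\gamma(p,x))_{x\in X}$ with $\gamma(p,x)=0$ if and only if $p\cdot x$ is undefined. For a word $u=x_0\cdots x_n$, $\gamma(q,u)=\gamma(q,x_0)\gamma(q\cdot x_0,x_1)\cdots\gamma(q\cdot(x_0\cdots x_{n-1}),x_n)$ (and $\gamma(q,u)=1$ for $u$ empty), and $\gamma_0(u)=\sum_{q\in Q}\gamma_0(q)\gamma(q,u)$. The measure $\mathbb{R}_n$ on words of length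 $n$ is $\mathbb{R}_n(u)=\gamma_0(u)$. The support is the set of words $u$ with $\gamma_0(u)\ne0$. A cycle with probability $1$ is a state $q$ and a non-empty word $u$ with $q\cdot u=q$ and $\gamma(q,u)=1$. It is assumed throughout that only reduced words can be read in $\mathcal{A}$. A sequence $(\mathbb{R}_n)_{n\ge0}$ of probability measures on $\mathcal{R}$ is prefix-heavy with parameters $(C,\alpha)$ ($C\ge1$, $0<\alpha<1$) if (1) the support of $\mathbb{R}_n$ is contained in $\mathcal{R}_n$ for every $n$, and (2) for every $n\ge0$ and $u\in\mathcal{R}$ with $\mathbb{R}_n(\mathcal{P}(u))\ne0$, and every $v\in\mathcal{R}$, $\mathbb{R}_n(\mathcal{P}(uv)\mid\mathcal{P}(u))\le C\alpha^{|v|}$. *)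

(* Defs.v *)
From HB Require Import structures.
From mathcomp Require Import all_boot all_order all_algebra.
From mathcomp Require Import all_classical all_reals all_analysis.

Set Implicit Arguments.
Unset Strict Implicit.
Unset Printing Implicit Defensive.

Import Order.TTheory GRing.Theory Num.Theory.
Local Open Scope classical_set_scope.
Local Open Scope ring_scope.

(* Words carry the discrete sigma-algebra; [word] is an alias of [seq] so that
   the instance is not put on [seq] itself. *)
Definition word (X : Type) : Type := seq X.

Section WordMeasurable.
Variable X : finType.

HB.instance Definition _ := Choice.on (word X).
HB.instance Definition _ := isPointed.Build (word X) [::].
HB.instance Definition _ := @isMeasurable.Build default_measure_display
  (word X) discrete_measurable discrete_measurable0
  discrete_measurableC discrete_measurableU.

End WordMeasurable.

(* [tilde A] is A together with its formal inverses: [inl a] is a and [inr a]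
   is a^-1. *)
Definition tilde (A : finType) : finType := (A + A)%type.

Definition letter_inv (A : finType) (x : tilde A) : tilde A :=
  match x with inl a => inr a | inr a => inl a end.

Section ReducedWords.
Variable A : finType.

Definition reduced (w : word (tilde A)) : bool :=
  [forall a : tilde A, ~~ infix [:: a; letter_inv a] w].

Definition reduced_words : set (word (tilde A)) := [set w | reduced w].

Definition reduced_words_of_size (n : nat) : set (word (tilde A)) :=
  [set w | reduced w /\ size w = n].

(* A prefix of a reduced word is reduced, so this is empty when u is not. *)
Definition cylinder (u : word (tilde A)) : set (word (tilde A)) :=
  [set w | reduced w /\ prefix u w].

End ReducedWords.

Arguments reduced_words : clear implicits.

Definition cond_prob d (T : measurableType d) (R : realType)
  (P : probability T R) (E F : set T) : R :=
  fine (P (E `&` F)) / fine (P F).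

(* A probability measure on reduced words is represented by one on all words;
   the support condition says that it is carried by the reduced ones. *)
Definition prefix_heavy (R : realType) (A : finType)
  (P : nat -> probability (word (tilde A)) R) (C alpha : R) : Prop :=
  [/\ 1 <= C,
      0 < alpha < 1,
      forall n (w : word (tilde A)), P n [set w] <> 0%E ->
        reduced_words_of_size n w
    & forall n (u v : word (tilde A)),
        reduced u -> reduced v -> P n (cylinder u) <> 0%E ->
        cond_prob (P n) (cylinder (u ++ v)) (cylinder u)
          <= C * alpha ^+ size v].

Record markov_automaton (R : realType) (X : finType) := MarkovAutomaton {
  state :> finType;
  state_nonempty : (0 < #|state|)%N;
  trans : state -> X -> option state;
  init : state -> R;
  init_itv : forall q, 0 <= init q <= 1;
  init_sum : \sum_(q : state) init q = 1;
  prob : state -> X -> R;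
  prob_itv : forall p x, 0 <= prob p x <= 1;
  prob_sum : forall p, \sum_(x : X) prob p x = 1;
  prob_eq0 : forall p x, prob p x = 0 <-> trans p x = None
}.

Section Automaton.
Variables (R : realType) (X : finType) (aut : markov_automaton R X).

Fixpoint run (q : aut) (u : word X) : option aut :=
  if u is x :: u' then
    if trans q x is Some q' then run q' u' else None
  else Some q.

(* In the [None] case the first factor [prob q x] is already 0. *)
Fixpoint word_prob (q : aut) (u : word X) : R :=
  if u is x :: u' then
    prob q x * (if trans q x is Some q' then word_prob q' u' else 0)
  else 1.

Definition init_prob (u : word X) : R :=
  \sum_(q : aut) init q * word_prob q u.

Definition prob1_cycle : Prop :=
  exists (q : aut) (u : word X),
    [/\ u <> [::], run q u = Some q & word_prob q u = 1].

Definition auto_support : set (word X) := [set u | init_prob u <> 0].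

Definition word_measure (n : nat) (S : set (word X)) : \bar R :=
  (\sum_(u : n.-tuple X) (init_prob u)%:E * \d_(u : word X) S)%E.

Lemma word_prob_ge0 q u : 0 <= word_prob q u.
Proof.
elim: u q => [|x u IHu] q //=; apply: mulr_ge0; last by case: trans.
by case/andP: (prob_itv q x).
Qed.

Lemma init_prob_ge0 u : 0 <= init_prob u.
Proof.
apply: sumr_ge0 => q _; apply: mulr_ge0 (word_prob_ge0 _ _).
by case/andP: (init_itv q).
Qed.

Lemma word_prob_sum q n : \sum_(u : n.-tuple X) word_prob q u = 1.
Proof.
elim: n q => [|n IHn] q.
  by rewrite (big_pred1 [tuple]) // => t; apply/esym/eqP; exact: tuple0.
rewrite -(prob_sum q).
rewrite (reindex (fun p : X * n.-tuple X => [tuple of p.1 :: p.2])) /=; last first.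
  exists (fun t : n.+1.-tuple X => (thead t, [tuple of behead t])).
    by case=> x t _ /=; rewrite theadE; congr (_, _); apply: val_inj.
  by move=> t _ /=; rewrite -tuple_eta.
rewrite -(pair_bigA _ (fun x (t : n.-tuple X) => prob q x *
  (if trans q x is Some q' then word_prob q' t else 0))) /=.
apply: eq_bigr => x _; rewrite -big_distrr /=.
case E: (trans q x) => [q'|]; first by rewrite IHn mulr1.
by rewrite big1 // mulr0; apply/esym/prob_eq0.
Qed.

Lemma init_prob_sum n : \sum_(u : n.-tuple X) init_prob u = 1.
Proof.
rewrite exchange_big -(init_sum aut) /=; apply: eq_bigr => q _.
by rewrite -big_distrr /= word_prob_sum mulr1.
Qed.

Section Measure.
Variable n : nat.
Local Open Scope ereal_scope.

Let mu0 : word_measure n set0 = 0.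
Proof. by rewrite /word_measure big1 // => u _; rewrite dirac0 mule0. Qed.

Let mu_ge0 S : 0 <= word_measure n S.
Proof.
by apply: sume_ge0 => u _; rewrite mule_ge0 // lee_fin init_prob_ge0.
Qed.

Let mu_sigma_additive : semi_sigma_additive (word_measure n).
Proof.
pose u i : word X := nth [::] [seq (val u : word X) | u <- enum {: n.-tuple X}] i.
pose w i : {nonneg R} := NngNum (init_prob_ge0 (u i)).
pose m := msum (fun i => mscale (w i) (dirac (u i))) #|{: n.-tuple X}|.
suff -> : word_measure n = m by exact: measure_semi_sigma_additive.
apply/funext => S; rewrite /word_measure /m /msum /mscale /= big_enum_val.
apply: eq_bigr => i _; have ui : u i = enum_val i.
  by rewrite /u (nth_map (enum_val i)) -?cardE // -enum_val_nth.
by rewrite /mscale /= ui.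
Qed.

HB.instance Definition _ := isMeasure.Build _ _ _
  (word_measure n) mu0 mu_ge0 mu_sigma_additive.

Let mu_setT : word_measure n setT = 1.
Proof.
rewrite /word_measure -(init_prob_sum n) -sumEFin.
by apply: eq_bigr => u _; rewrite diracT mule1.
Qed.

HB.instance Definition _ := Measure_isProbability.Build _ _ _
  (word_measure n) mu_setT.

End Measure.

Definition word_law (n : nat) : probability (word X) R := word_measure n.

End Automaton.

(* Kleene's partial recursive functions with oracles.  A Markovian automaton
   has real parameters, so "computable from the automaton" is understood as in
   computable analysis: the program may query the combinatorial data of the
   automaton exactly, and its probabilities up to any precision 2^-k; it must
   output the real number up to any given precision 2^-k. *)

Inductive query := LetterCount | StateCount | Trans | Init | Prob.

Definition oracle := query -> seq nat -> nat.

Inductive program :=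
| PZero
| PSucc
| PProj of nat
| PComp of program & seq program
| PRec of program & program
| PMin of program
| PCall of query.

(* [eval o p s y]: with oracle o, the program p halts on input s with output y.
   Missing arguments are read as 0. *)
Fixpoint eval (o : oracle) (p : program) (s : seq nat) (y : nat) : Prop :=
  match p with
  | PZero => y = 0%N
  | PSucc => y = (nth 0%N s 0).+1
  | PProj i => y = nth 0%N s i
  | PComp f gs =>
      exists zs : seq nat,
        (fix evals (gs : seq program) (zs : seq nat) : Prop :=
           match gs, zs with
           | [::], [::] => True
           | g :: gs', z :: zs' => eval o g s z /\ evals gs' zs'
           | _, _ => False
           end) gs zs
        /\ eval o f zs y
  | PRec f g =>
      (fix rec (n y : nat) : Prop :=
         if n is m.+1 then
           exists z, rec m z /\ eval o g [:: m, z & behead s] y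
         else eval o f (behead s) y) (head 0%N s) y
  | PMin f =>
      eval o f (y :: s) 0%N
      /\ forall m, (m < y)%N -> exists z, eval o f (m :: s) z.+1
  | PCall q => y = o q s
  end.

Definition dyadic_approx (R : realType) (r : R) (k m : nat) : Prop :=
  `|m%:R / 2 ^+ k - r| <= (2 ^+ k)^-1.

Section Computability.
Variables (R : realType) (X : finType) (aut : markov_automaton R X).

(* States and letters are numbered by [enum_rank]; an undefined transition is
   answered by 0, a transition to state number j by j + 1. *)
Definition describes (o : oracle) : Prop :=
  [/\ o LetterCount [::] = #|X|,
      o StateCount [::] = #|aut|,
      forall (p : aut) (x : X),
        o Trans [:: enum_rank p : nat; enum_rank x : nat] =
          (if trans p x is Some q then (enum_rank q).+1 else 0%N),
      forall (p : aut) k,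
        dyadic_approx (init p) k (o Init [:: enum_rank p : nat; k])
    & forall (p : aut) (x : X) k,
        dyadic_approx (prob p x) k
          (o Prob [:: enum_rank p : nat; enum_rank x : nat; k])].

(* Only natural numerators are used for approximations, which is enough for
   nonnegative reals. *)
Definition computes (prg : program) (r : R) : Prop :=
  forall o, describes o ->
  forall k, exists m, eval o prg [:: k] m /\ dyadic_approx r k m.

End Computability.

(* Main.v *)
(* Let N be the number of states and delta <= 1 the least positive transition
   probability.  A transition has probability 1 or at most 1 - delta; without a
   cycle of probability 1, the pigeonhole principle shows that a word of length
   N has probability at most 1 - delta from any state.  By Bernoulli's
   inequality alpha = 1 - delta / 2^(N+1) satisfies
   alpha^N >= 1 - delta / 2 >= max (1/2, 1 - delta), so cutting a word into
   blocks of length N gives the bound 2 * alpha^|v|.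
   The power of 2 in the definition of alpha makes it easy to compute: an
   approximation of alpha to precision 2^-k is 1 - a / 2^k, where a is the
   minimum of the numerators returned by the oracle at precision
   2^-(k - N - 1), with truncated subtraction. *)
Require Import Defs.
From mathcomp Require Import all_boot all_order all_algebra.
From mathcomp Require Import all_classical all_reals all_analysis.
From mathcomp Require Import ring lra.

Import Order.TTheory GRing.Theory Num.Theory.
Local Open Scope classical_set_scope.
Local Open Scope ring_scope.

(** * Partial recursive programs for arithmetic and for the two constants *)

Section Programs.
Set Implicit Arguments.
Unset Strict Implicit.
Local Notation eval := Defs.eval.
Variable o : oracle.
Local Open Scope nat_scope.

Lemma eval_comp1 f g s z y :
  eval o g s z -> eval o f [:: z] y -> eval o (PComp f [:: g]) s y.
Proof. by move=> gz fy; exists [:: z]. Qed.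

Lemma eval_comp2 f g1 g2 s z1 z2 y :
  eval o g1 s z1 -> eval o g2 s z2 -> eval o f [:: z1; z2] y ->
  eval o (PComp f [:: g1; g2]) s y.
Proof. by move=> gz1 gz2 fy; exists [:: z1; z2]. Qed.

Lemma eval_comp3 f g1 g2 g3 s z1 z2 z3 y :
  eval o g1 s z1 -> eval o g2 s z2 -> eval o g3 s z3 ->
  eval o f [:: z1; z2; z3] y -> eval o (PComp f [:: g1; g2; g3]) s y.
Proof. by move=> gz1 gz2 gz3 fy; exists [:: z1; z2; z3]. Qed.

Lemma eval_comp4 f g1 g2 g3 g4 s z1 z2 z3 z4 y :
  eval o g1 s z1 -> eval o g2 s z2 -> eval o g3 s z3 -> eval o g4 s z4 ->
  eval o f [:: z1; z2; z3; z4] y -> eval o (PComp f [:: g1; g2; g3; g4]) s y.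
Proof. by move=> gz1 gz2 gz3 gz4 fy; exists [:: z1; z2; z3; z4]. Qed.

Lemma eval_rec0 f g s y : eval o f s y -> eval o (PRec f g) (0 :: s) y.
Proof. by []. Qed.

Lemma eval_recS f g n s z y :
  eval o (PRec f g) (n :: s) z -> eval o g [:: n, z & s] y ->
  eval o (PRec f g) (n.+1 :: s) y.
Proof. by move=> nz gy; exists z. Qed.

Lemma eval_const q s : eval o (PComp (PCall q) [::]) s (o q [::]).
Proof. by exists [::]. Qed.

Definition prog_add := PRec (PProj 0) (PComp PSucc [:: PProj 1]).

Lemma eval_add a b : eval o prog_add [:: a; b] (a + b).
Proof.
elim: a => [|a IHa]; first exact: eval_rec0.
by apply: eval_recS IHa _; apply: eval_comp1.
Qed.

Definition prog_exp2 :=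
  PRec (PComp PSucc [:: PZero]) (PComp prog_add [:: PProj 1; PProj 1]).

Lemma eval_exp2 k s : eval o prog_exp2 (k :: s) (2 ^ k).
Proof.
elim: k => [|k IHk]; first by apply: eval_rec0; apply: (@eval_comp1 _ _ _ 0).
apply: eval_recS IHk _; rewrite expnS mul2n -addnn.
by apply: eval_comp2 (eval_add _ _).
Qed.

Definition prog_pred := PRec PZero (PProj 0).

Lemma eval_pred n : eval o prog_pred [:: n] n.-1.
Proof.
elim: n => [|n IHn]; first exact: eval_rec0.
by apply: eval_recS IHn _.
Qed.

(* The subtrahend is the first argument: it drives the recursion. *)
Definition prog_rsub := PRec (PProj 0) (PComp prog_pred [:: PProj 1]).

Lemma eval_rsub b a : eval o prog_rsub [:: b; a] (a - b).
Proof.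
elim: b => [|b IHb]; first by rewrite subn0; exact: eval_rec0.
apply: eval_recS IHb _; rewrite subnS.
by apply: eval_comp1 (eval_pred _).
Qed.

(** The minimum is [a - (a - b)] with truncated subtraction. *)
Definition prog_min :=
  PComp prog_rsub [:: PComp prog_rsub [:: PProj 1; PProj 0]; PProj 0].

Lemma eval_min a b : eval o prog_min [:: a; b] (minn a b).
Proof.
rewrite minnE; apply: eval_comp2 (eval_rsub _ _) => //.
by apply: eval_comp2 (eval_rsub _ _).
Qed.

(** The recursion serves only as a case split: the step sees [[:: m; z; a; b]], ignores the
    recursive value [z] and returns [b]. *)
Definition prog_ifz := PRec (PProj 0) (PProj 3).

Lemma eval_ifz c a b :
  eval o prog_ifz [:: c; a; b] (if c == 0 then a else b).
Proof.
elim: c => [|c IHc]; first exact: eval_rec0.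
by apply: eval_recS IHc _.
Qed.

(* On input [:: L; z; i; k]: the minimum of z and of the approximations, to
   precision k, of the probabilities of the letters j < L readable in state i. *)
Definition prog_min_letters :=
  PRec (PProj 0)
    (PComp prog_ifz
       [:: PComp (PCall Trans) [:: PProj 3; PProj 0];
           PProj 1;
           PComp prog_min
             [:: PProj 1;
                 PComp (PCall Prob) [:: PProj 3; PProj 0; PProj 4]]]).

(** The minimum is described by its lower bounds, a form that passes through the induction.
    Arguments are evaluated eagerly, so [Prob] is queried even at an undefined transition;
    [prog_ifz] then discards the answer. *)
Lemma eval_min_letters L z i k :
  exists a, eval o prog_min_letters [:: L; z; i; k] a /\
    forall m, m <= a <-> m <= z /\
      forall j, j < L -> o Trans [:: i; j] <> 0 -> m <= o Prob [:: i; j; k].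
Proof.
elim: L => [|L [a [La aP]]].
  by exists z; split; [exact: eval_rec0 | move=> m; split=> [|[]]].
exists (if o Trans [:: i; L] == 0 then a else minn a (o Prob [:: i; L; k])).
split.
  apply: eval_recS La _; apply: eval_comp3 (eval_ifz _ _ _) => //.
    exact: eval_comp2.
  by apply: eval_comp2 (eval_min _ _) => //; exact: eval_comp3.
move=> m; case: eqP => [T0|Tn0].
  rewrite aP; split=> -[mz mP]; split=> // j.
    by rewrite ltnS leq_eqVlt => /orP[/eqP -> //|]; exact: mP.
  by move=> jL; apply: mP; exact: ltnW.
rewrite leq_min; split=> [/andP[/aP[mz mP] mL]|[mz mP]].
  by split=> // j; rewrite ltnS leq_eqVlt => /orP[/eqP -> //|]; exact: mP.
apply/andP; split; last exact: mP.
by apply/aP; split=> // j jL; apply: mP; exact: ltnW.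
Qed.

(** The recursion runs over the states and starts from [2 ^ k], the numerator of 1 at precision [k],
    to match the start value of [min_prob]. *)
Definition prog_min_prob :=
  PRec prog_exp2
    (PComp prog_min_letters
       [:: PComp (PCall LetterCount) [::]; PProj 1; PProj 0; PProj 2]).

Lemma eval_min_prob N k :
  exists a, eval o prog_min_prob [:: N; k] a /\
    forall m, m <= a <-> m <= 2 ^ k /\
      forall i j, i < N -> j < o LetterCount [::] ->
        o Trans [:: i; j] <> 0 -> m <= o Prob [:: i; j; k].
Proof.
elim: N => [|N [a [Na aP]]].
  exists (2 ^ k); split; first by apply: eval_rec0; exact: eval_exp2.
  by move=> m; split=> [|[]].
have [b [Nb bP]] := eval_min_letters (o LetterCount [::]) a N k.
exists b; split.
  by apply: eval_recS Na _; apply: eval_comp4 Nb => //; exact: eval_const.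
move=> m; rewrite bP aP; split=> [[[mk mP] mN]|[mk mP]].
  split=> // i j; rewrite ltnS leq_eqVlt => /orP[/eqP ->|]; first exact: mN.
  exact: mP.
split; last by move=> j; exact: mP.
by split=> // i j iN; apply: mP; exact: ltnW.
Qed.

Definition prog_C := PComp prog_exp2 [:: PSucc].

Lemma eval_C k : eval o prog_C [:: k] (2 ^ k.+1).
Proof. by apply: eval_comp1 (eval_exp2 _ _). Qed.

Definition prog_alpha :=
  PComp prog_rsub
    [:: PComp prog_min_prob
          [:: PComp (PCall StateCount) [::];
              PComp prog_rsub
                [:: PComp PSucc [:: PComp (PCall StateCount) [::]]; PProj 0]];
        prog_exp2].

Lemma eval_alpha k a :
  eval o prog_min_prob
    [:: o StateCount [::]; k - (o StateCount [::]).+1] a ->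
  eval o prog_alpha [:: k] (2 ^ k - a).
Proof.
move=> ka; apply: eval_comp2 (eval_rsub _ _); last exact: eval_exp2.
apply: eval_comp2 ka; first exact: eval_const.
apply: eval_comp2 (eval_rsub _ _) => //.
by apply: eval_comp1; first exact: eval_const.
Qed.

End Programs.

Lemma bernoulli_le (R : realFieldType) (x : R) n :
  0 <= x <= 1 -> 1 - n%:R * x <= (1 - x) ^+ n.
Proof.
case/andP=> x0 x1; elim: n => [|n IHn]; first by rewrite mul0r subr0 expr0.
have n0 : 0 <= n%:R :> R by exact: ler0n.
by rewrite exprS -natr1; nra.
Qed.

(** * Word probabilities: the gap below 1 and cycles *)

Section WordProbability.
Set Implicit Arguments.
Unset Strict Implicit.
Variables (R : realType) (X : finType) (aut : markov_automaton R X).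
Implicit Types (q p : aut) (u v : word X).

Lemma word_prob_le1 q u : word_prob q u <= 1.
Proof.
elim: u q => [|x u IHu] q //=; have /andP[p0 p1] := prob_itv q x.
case: (trans q x) => [q'|]; last by rewrite mulr0.
have := word_prob_ge0 q' u; have := IHu q'; nra.
Qed.

Lemma word_prob_cat q u v :
  word_prob q (u ++ v) =
    word_prob q u * (if run q u is Some q' then word_prob q' v else 0).
Proof.
elim: u q => [|x u IHu] q /=; first by rewrite mul1r.
by case: (trans q x) => [q'|]; rewrite ?mulr0 // IHu mulrA.
Qed.

Lemma run_cat q u v :
  run q (u ++ v) = if run q u is Some q' then run q' v else None.
Proof. by elim: u q => [|x u IHu] q //=; case: (trans q x). Qed.

(** Two factors in [0, 1] with product 1 are both 1. *)
Lemma word_prob_cat1 q u v : word_prob q (u ++ v) = 1 ->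
  word_prob q u = 1 /\ exists2 q', run q u = Some q' & word_prob q' v = 1.
Proof.
rewrite word_prob_cat; case: (run q u) => [q'|]; last first.
  by rewrite mulr0 => /eqP; rewrite eq_sym oner_eq0.
have := word_prob_ge0 q u; have := word_prob_le1 q u.
have := word_prob_ge0 q' v; have := word_prob_le1 q' v => h1 h2 h3 h4 h5.
have u1 : word_prob q u = 1 by nra.
by split=> //; exists q' => //; rewrite -h5 u1 mul1r.
Qed.

(** This is delta; starting the minimum at 1 gives [min_prob <= 1] at once. *)
Definition min_prob : R :=
  \big[Num.min/1]_(px : aut * X | isSome (trans px.1 px.2)) prob px.1 px.2.

Lemma prob_neq0 q x : (prob q x != 0) = isSome (trans q x).
Proof.
apply/idP/idP => [/eqP p0|Ex].
  by case E: (trans q x) => //; case: p0; exact/prob_eq0.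
by apply/eqP => /prob_eq0 E; rewrite E in Ex.
Qed.

Lemma min_prob_gt0 : 0 < min_prob.
Proof.
apply/bigmin_gtP; split=> // -[q x] /= qx.
by rewrite lt_neqAle eq_sym prob_neq0 qx; case/andP: (prob_itv q x).
Qed.

Lemma min_prob_le1 : min_prob <= 1.
Proof. exact: bigmin_le_id. Qed.

Lemma min_prob_le q x : isSome (trans q x) -> min_prob <= prob q x.
Proof. by move=> qx; apply: (@bigmin_le_cond _ _ _ _ (q, x)). Qed.

(** Another letter readable in [q] takes at least [min_prob] of the total mass 1; if there is none,
    [x] carries all of it. *)
Lemma prob_dichotomy q x : prob q x = 1 \/ prob q x <= 1 - min_prob.
Proof.
have := prob_sum q; rewrite (bigD1 x) //=.
have [y /andP[yx qy]|none] := pickP [pred y | (y != x) && isSome (trans q y)].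
  rewrite (bigD1 y) //= => S1; right.
  have := min_prob_le qy; set s := \sum_(_ | _) _ in S1.
  have : 0 <= s by apply: sumr_ge0 => z _; case/andP: (prob_itv q z).
  lra.
rewrite big1 ?addr0; first by left.
move=> y yx; apply/eqP; rewrite -[_ == _]negbK prob_neq0.
by have := none y; rewrite /= yx /= => ->.
Qed.

Lemma word_prob_dichotomy q u :
  word_prob q u = 1 \/ word_prob q u <= 1 - min_prob.
Proof.
have d1 := min_prob_le1.
elim: u q => [|x u IHu] q /=; first by left.
have /andP[p0 p1] := prob_itv q x.
case: (trans q x) => [q'|]; last by right; rewrite mulr0 subr_ge0.
have w0 := word_prob_ge0 q' u; have w1 := word_prob_le1 q' u.
case: (prob_dichotomy q x) => px; last by right; nra.
by rewrite px mul1r.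
Qed.

(** Pigeonhole: the run visits [(size u).+1] states, so two coincide, and the factor read between
    them again has probability 1. *)
Lemma prob1_word_cycle q u :
  (#|aut| <= size u)%N -> word_prob q u = 1 -> prob1_cycle aut.
Proof.
(* The default [q] is never returned: every prefix of a word of probability 1 can be read. *)
move=> Nu u1; pose st i := odflt q (run q (take i u)).
have runst i : run q (take i u) = Some (st i).
  rewrite /st; have : word_prob q (take i u ++ drop i u) = 1 by rewrite cat_take_drop.
  by case/word_prob_cat1=> _ [q' ->].
have : ~~ uniq (mkseq st (size u).+1).
  apply/negP => /card_uniqP; rewrite size_mkseq => cE.
  by have := max_card (mem (mkseq st (size u).+1)); rewrite cE leqNgt ltnS Nu.
case/(uniqPn q) => i [j [ij]]; rewrite size_mkseq => ju.
rewrite !nth_mkseq //; last exact: ltn_trans ju.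
move=> stij; pose w := drop i (take j u).
have tjE : take j u = take i u ++ w.
  by rewrite /w -{1}(cat_take_drop i (take j u)) take_takel // ltnW.
exists (st i), w; split.
- move/(congr1 size); rewrite size_drop size_takel //.
  by move/eqP; rewrite subn_eq0 leqNgt ij.
- by have := runst j; rewrite tjE run_cat runst -stij.
have : word_prob q (take j u ++ drop j u) = 1 by rewrite cat_take_drop.
case/word_prob_cat1; rewrite tjE => /word_prob_cat1[_ [q' + w1]] _.
by rewrite runst => -[->].
Qed.

(** * Exponential decay of word probabilities *)

Definition decay_rate : R := 1 - min_prob / 2 ^+ (#|aut|).+1.

Lemma decay_rate_itv : 0 < decay_rate < 1.
Proof.
have d0 := min_prob_gt0; have d1 := min_prob_le1.
have N0 : 0 < 2 ^+ (#|aut|).+1 :> R by rewrite exprn_gt0.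
have N1 : 1 < 2 ^+ (#|aut|).+1 :> R by rewrite exprn_egt1 // ltr1n.
by rewrite /decay_rate subr_gt0 gtrBl divr_gt0 // ltr_pdivrMr // mul1r (le_lt_trans d1).
Qed.

(** Bernoulli's inequality loses [N * min_prob / 2 ^ N.+1], which is at most [min_prob / 2] because
    [N < 2 ^ N]. *)
Lemma decay_rate_exp : 1 - min_prob / 2 <= decay_rate ^+ #|aut|.
Proof.
have d0 := min_prob_gt0; have d1 := min_prob_le1.
have /andP[r0 r1] := decay_rate_itv.
set N := #|aut|; pose x := min_prob / 2 ^+ N.+1.
have x01 : 0 <= x <= 1 by move: r0 r1; rewrite /decay_rate -/x; lra.
apply: le_trans (bernoulli_le N x01).
have -> : N%:R * x = min_prob / 2 * (N%:R / 2 ^+ N).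
  by rewrite /x exprS invfM; ring.
rewrite lerD2l lerN2 ler_piMr ?divr_ge0 ?(ltW d0) //.
by rewrite ler_pdivrMr ?exprn_gt0 // mul1r -natrX ler_nat ltnW // ltn_expl.
Qed.

Lemma word_prob_decay q v :
  ~ prob1_cycle aut -> word_prob q v <= 2 * decay_rate ^+ size v.
Proof.
move=> nocycle; have d0 := min_prob_gt0; have d1 := min_prob_le1.
have rN := decay_rate_exp; have /andP[r0 r1] := decay_rate_itv.
have [n] := ubnP (size v); elim: n v q => // n IHn v q vn.
have [vN|Nv] := ltnP (size v) #|aut|.
  (* For a short word the power of [decay_rate] is still at least 1/2; the constant 2 compensates
     for this. *)
  apply: le_trans (word_prob_le1 _ _) _.
  have : decay_rate ^+ #|aut| <= decay_rate ^+ size v.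
    by rewrite ler_wiXn2l ?(ltW r0) ?(ltW r1) // ltnW.
  lra.
rewrite -{1}(cat_take_drop #|aut| v) word_prob_cat.
have tN : size (take #|aut| v) = #|aut| by rewrite size_takel.
(* A full block cannot have probability 1, since it would contain a cycle of probability 1. *)
have tv : word_prob q (take #|aut| v) <= decay_rate ^+ #|aut|.
  case: (word_prob_dichotomy q (take #|aut| v)) => t; last by lra.
  by case: nocycle; apply: prob1_word_cycle t; rewrite tN.
rewrite -(subnKC Nv) exprD mulrCA; apply: ler_pM => //.
- exact: word_prob_ge0.
- by case: (run _ _) => // q'; exact: word_prob_ge0.
case: (run _ _) => [q'|]; last by rewrite mulr_ge0 // exprn_ge0 // ltW.
rewrite -size_drop; apply: IHn; rewrite size_drop.
apply: leq_trans (_ : size v <= n)%N => //.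
(* There is at least one state, so removing a block shortens the word. *)
by rewrite ltn_subrL state_nonempty (leq_trans (state_nonempty aut)).
Qed.

(** The decay bound is uniform in the state reached after [u], so it factors out of the average over
    initial states. *)
Lemma init_prob_decay u v : ~ prob1_cycle aut ->
  init_prob aut (u ++ v) <= 2 * decay_rate ^+ size v * init_prob aut u.
Proof.
move=> nocycle; rewrite /init_prob mulr_sumr; apply: ler_sum => q _.
rewrite mulrCA; have /andP[i0 _] := init_itv q; apply: ler_wpM2l => //.
rewrite word_prob_cat mulrC ler_wpM2r ?word_prob_ge0 //.
case: (run q u) => [q'|]; first exact: word_prob_decay.
by have /andP[r0 _] := decay_rate_itv; rewrite mulr_ge0 // exprn_ge0 // ltW.
Qed.

(** * Total probability of the words with a given prefix *)

Lemma word_prob_sum_prefix q u n : (size u <= n)%N ->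
  \sum_(t : n.-tuple X) word_prob q t * (prefix u t)%:R = word_prob q u.
Proof.
elim: u q n => [|y u IHu] q n /=.
  move=> _; rewrite -[RHS](word_prob_sum q n); apply: eq_bigr => t _.
  by rewrite prefix0s /= mulr1n mulr1.
case: n => // n un.
rewrite (reindex (fun p : X * n.-tuple X => [tuple of p.1 :: p.2])) /=; last first.
  exists (fun t : n.+1.-tuple X => (thead t, [tuple of behead t])).
    by case=> x t _ /=; rewrite theadE; congr (_, _); apply: val_inj.
  by move=> t _ /=; rewrite -tuple_eta.
rewrite -(pair_bigA _ (fun x (t : n.-tuple X) =>
  prob q x * (if trans q x is Some q' then word_prob q' t else 0) *
    ((y == x) && prefix u t)%:R)) /=.
rewrite (bigD1 y) //= [X in _ + X]big1 => [|x /negPf xy]; last first.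
  by apply: big1 => t _; rewrite eq_sym xy /= mulr0n mulr0.
rewrite addr0 eqxx /=; case: (trans q y) => [q'|].
  by rewrite -(IHu q' n) // mulr_sumr; apply: eq_bigr => t _; rewrite mulrA.
by rewrite mulr0 big1 // => t _; rewrite mul0r.
Qed.

Lemma init_prob_sum_prefix u n : (size u <= n)%N ->
  \sum_(t : n.-tuple X) init_prob aut t * (prefix u t)%:R = init_prob aut u.
Proof.
move=> un; under eq_bigr do rewrite /init_prob mulr_suml.
rewrite exchange_big /=; apply: eq_bigr => q _.
rewrite -(word_prob_sum_prefix q un) mulr_sumr.
by apply: eq_bigr => t _; rewrite mulrA.
Qed.

Lemma word_lawE n (S : set (word X)) :
  word_law aut n S =
    (\sum_(t : n.-tuple X) init_prob aut t * ((t : word X) \in S)%:R)%:E.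
Proof.
rewrite -sumEFin; apply: eq_bigr => t _.
by rewrite diracE.
Qed.

End WordProbability.

(** * Cylinder masses and prefix-heaviness *)

Section ReducedSupport.
Set Implicit Arguments.
Unset Strict Implicit.
Variables (R : realType) (A : finType) (aut : markov_automaton R (tilde A)).
Hypothesis support_reduced : auto_support aut `<=` reduced_words A.

(** Words that are not reduced have weight 0, so only the prefix condition matters; no word of
    length [n] has a longer prefix. *)
Lemma word_law_cylinder n (u : word (tilde A)) :
  word_law aut n (cylinder u) =
    (if (size u <= n)%N then init_prob aut u else 0)%:E.
Proof.
rewrite word_lawE; congr _%:E; transitivity
  (\sum_(t : n.-tuple (tilde A)) init_prob aut t * (prefix u t)%:R).
  apply: eq_bigr => t _; have [->|t0] := eqVneq (init_prob aut t) 0.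
    by rewrite !mul0r.
  have tr : reduced (t : word (tilde A)) by apply: support_reduced; exact/eqP.
  congr (_ * _%:R); congr nat_of_bool.
  by apply/idP/idP => [|ut]; rewrite inE; [case|].
case: leqP => un; first exact: init_prob_sum_prefix.
apply: big1 => t _; case: (boolP (prefix u t)) => [/size_prefix|]; rewrite ?mulr0 //.
by rewrite size_tuple leqNgt un.
Qed.

Lemma word_law_support n (w : word (tilde A)) :
  word_law aut n [set w] <> 0%E -> reduced_words_of_size n w.
Proof.
rewrite word_lawE => w0; have [t /andP[t0 /eqP tw]|none] := pickP
  [pred t : n.-tuple (tilde A) | (init_prob aut t != 0) && (tval t == w)].
  by rewrite -tw; split; [apply: support_reduced; exact/eqP | exact: size_tuple].
case: w0; congr _%:E; apply: big1 => t _; have := none t => /=.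
case: eqVneq => [-> _|_ /= tw]; first by rewrite mul0r.
by rewrite [_ \in _](_ : _ = false) ?mulr0 //; apply/negP; rewrite inE => /eqP; rewrite tw.
Qed.

Lemma word_law_prefix_heavy : ~ prob1_cycle aut ->
  prefix_heavy (word_law aut) 2 (decay_rate aut).
Proof.
move=> nocycle; have r01 := decay_rate_itv aut; split=> //.
- by rewrite ler1n.
- exact: word_law_support.
move=> n u v _ _ u0; rewrite /cond_prob.
have -> : cylinder (u ++ v) `&` cylinder u = cylinder (u ++ v).
  apply/seteqP; split=> [w []//|w [wr uvw]]; split; split=> //.
  exact: prefix_trans (prefix_prefix _ _) uvw.
move: u0; rewrite !word_law_cylinder /=.
(* A cylinder of nonzero mass forces [size u <= n]. *)
case: (leqP (size u) n) => // un /eqP; rewrite eqe => u0.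
rewrite ler_pdivrMr; last by rewrite lt_neqAle eq_sym u0 init_prob_ge0.
case: leqP => _; first exact: init_prob_decay.
(* Here [u ++ v] is longer than [n], so the numerator is 0. *)
case/andP: r01 => r0 _; rewrite !mulr_ge0 ?init_prob_ge0 //.
by rewrite exprn_ge0 // ltW.
Qed.

End ReducedSupport.

(** * Correctness of the programs for the two constants *)

Section Computation.
Set Implicit Arguments.
Unset Strict Implicit.
Variables (R : realType) (X : finType) (aut : markov_automaton R X).

Lemma computes_C : computes aut prog_C (2 : R).
Proof.
move=> o _ k; exists (2 ^ k.+1)%N; split; first exact: eval_C.
rewrite /Defs.dyadic_approx natrX exprS mulfK ?expf_neq0 ?pnatr_eq0 //.
by rewrite subrr normr0 invr_ge0 exprn_ge0.
Qed.

Lemma dyadic_approxE (r : R) k m :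
  Defs.dyadic_approx r k m <-> `|m%:R - r * 2 ^+ k| <= 1.
Proof.
have k0 : 0 < 2 ^+ k :> R by rewrite exprn_gt0.
rewrite /Defs.dyadic_approx -[m%:R in X in _ <-> X](divfK (lt0r_neq0 k0)) -mulrBl.
by rewrite normrM (gtr0_norm k0) -ler_pdivlMr // div1r.
Qed.

Lemma min_prob_approx o k : describes aut o ->
  exists a : nat, [/\ Defs.eval o prog_min_prob [:: #|aut|; k] a,
    (a <= 2 ^ k)%N & Defs.dyadic_approx (min_prob aut) k a].
Proof.
case=> oL _ oT _ oP; have [a [evala aP]] := eval_min_prob o #|aut| k.
have k0 : 0 < 2 ^+ k :> R by rewrite exprn_gt0.
have [ak aprob] := (aP a).1 (leqnn a).
exists a; split=> //; apply/dyadic_approxE; rewrite ler_norml; apply/andP; split.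
  (* Were [a] too small, [a.+1] would still be below [2 ^ k] and all the numerators, contradicting
     the maximality of [a] among lower bounds. *)
  rewrite leNgt; apply/negP => alt.
  suff : (a.+1 <= a)%N by rewrite ltnn.
  apply/aP; split=> [|i j iN].
    have d1 := min_prob_le1 aut; rewrite -(ler_nat R) natrX -natr1; nra.
  rewrite oL => jL; have := oT (enum_val (Ordinal iN)) (enum_val (Ordinal jL)).
  have := oP (enum_val (Ordinal iN)) (enum_val (Ordinal jL)) k.
  rewrite !enum_valK /=.
  set p := enum_val _; set x := enum_val _ => /dyadic_approxE; rewrite ler_norml.
  case/andP=> px _ -> qx; have := @min_prob_le _ _ aut p x.
  case: (trans p x) qx => // q _ /(_ isT) dp.
  rewrite -(ltr_nat R); nra.
rewrite lerBlDr -lerBlDl -ler_pdivrMr //; apply/bigmin_geP; split=> [|[p x] /= px].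
  have : a%:R <= 2 ^+ k :> R by rewrite -natrX ler_nat.
  by rewrite ler_pdivrMr //; lra.
have ap : (a <= o Prob [:: enum_rank p : nat; enum_rank x : nat; k])%N.
  by apply: aprob; rewrite ?oL // oT; case: (trans p x) px.
have /dyadic_approxE := oP p x k; rewrite ler_norml => /andP[_].
rewrite ler_pdivrMr //; move: ap; rewrite -(ler_nat R); lra.
Qed.

Lemma computes_alpha : computes aut prog_alpha (decay_rate aut).
Proof.
move=> o od k; have oN : o StateCount [::] = #|aut| by case: od.
set N := #|aut| in oN *; have [a [evala ak /dyadic_approxE approx]] := min_prob_approx (k - N.+1)%N od.
exists (2 ^ k - a)%N; split; first by apply: eval_alpha; rewrite oN.
apply/dyadic_approxE.
have d0 := min_prob_gt0 aut; have d1 := min_prob_le1 aut.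
have N0 : 0 < 2 ^+ N.+1 :> R by rewrite exprn_gt0.
have ak2 : (a <= 2 ^ k)%N by apply: leq_trans ak _; rewrite leq_exp2l ?leq_subr.
(* The division by [2 ^ N.+1] in [decay_rate] turns the error at precision [k] into that of
   [min_prob] at precision [k - N.+1]. *)
have -> : (2 ^ k - a)%:R - decay_rate aut * 2 ^+ k =
    min_prob aut * (2 ^+ k / 2 ^+ N.+1) - a%:R :> R.
  by rewrite natrB // natrX /decay_rate -/N; ring.
rewrite distrC; have [Nk|kN] := ltnP N k.
  by move: approx; rewrite expfB_cond ?pnatr_eq0.
(* When [k <= N] the precision truncates to 0; both [a] and the scaled [min_prob] then lie in
   [0, 1], so they differ by at most 1. *)
have kN0 : (k - N.+1 = 0)%N by apply/eqP; rewrite subn_eq0 leqW.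
rewrite kN0 expn0 in ak.
have q0 : 0 <= 2 ^+ k / 2 ^+ N.+1 :> R by rewrite divr_ge0 ?exprn_ge0.
have q1 : 2 ^+ k / 2 ^+ N.+1 <= 1 :> R.
  by rewrite ler_pdivrMr // mul1r ler_weXn2l ?ler1n // leqW.
move: q0 q1; set q := _ / _ => q0 q1.
have a0 : 0 <= a%:R :> R by [].
have a1 : a%:R <= 1 :> R by rewrite -[1]/(1%:R) ler_nat.
by rewrite ler_norml; nra.
Qed.

End Computation.

Theorem proposition4p3 (R : realType) :
  exists progC progalpha : program,
    forall (A : finType) (aut : markov_automaton R (tilde A)),
      (0 < #|A|)%N ->
      auto_support aut `<=` reduced_words A ->
      ~ prob1_cycle aut ->
      exists C alpha : R,
        [/\ 1 <= C, 0 < alpha < 1,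
            computes aut progC C, computes aut progalpha alpha
          & prefix_heavy (word_law aut) C alpha].
Proof.
exists prog_C, prog_alpha => A aut _ support_reduced nocycle.
exists 2, (decay_rate aut); split.
- by rewrite ler1n.
- exact: decay_rate_itv.
- exact: computes_C.
- exact: computes_alpha.
- exact: word_law_prefix_heavy.
Qed.
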